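(* Let $G$ be a finite nilpotent group. Then $\Gamma_1(G)$ is connected if and only if $G$ is cyclic, or $G$ is a generalized quaternion group, or $G$ is not a $p$-group for any prime $p$.
   Context: For a finite group $G$, $\Gamma_1(G)$ is the simple undirected graph with vertex set $G\setminus\{1\}$, in which two distinct vertices $x,y$ are adjacent if and only if one of them is a power of the other. The empty graph (case of trivial $G$) is counted as connected. The generalized quaternion groups are the groups $Q_n=\langle a,b \mid a^n=b^2,\ b^{-1}aba=b^4=1\rangle$ (of order $4n$) with $n\ge 2$; in particular the quaternion group of order $8$ is included. The trivial group is a $p$-group for every prime $p$. *)

(* Defs.v *)
From HB Require Import structures.
From mathcomp Require Import all_boot all_order all_fingroup all_solvable.

Set Implicit Arguments.
Unset Strict Implicit.
Unset Printing Implicit Defensive.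

Import GroupScope.

(* x \in <[y]> says that x is a power of y (cycleP). The relation lives on the *)
(* whole type, but both endpoints of an edge lie in the vertex set G^#.        *)
Definition power_graph (gT : finGroupType) (G : {set gT}) : rel gT :=
  [rel x y | [&& x \in G^#, y \in G^#, x != y
               & (x \in <[y]>) || (y \in <[x]>)]].

Definition power_graph_connected (gT : finGroupType) (G : {set gT}) : Prop :=
  {in G^# &, forall x y, connect (power_graph G) x y}.

(* Q_n has order 4n and n need not be a power of 2, unlike for the library's   *)
(* 'Q_m. Since Q_n is finite, \isog Grp, which only ranges over finite groups, *)
(* does express isomorphism with the presented group.                          *)
Definition generalized_quaternion (gT : finGroupType) (G : {set gT}) : Prop :=
  exists2 n : nat, (2 <= n)%N &
    G \isog Grp (a : b : (a ^+ n = b ^+ 2, b^-1 * a * b * a = b ^+ 4 = 1)).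

(* Main.v *)
(* In a p-group, x |-> 'Ohm_1(<[x]>) is constant on the edges of the power     *)
(* graph, so a connected G has a single subgroup of order p, which leaves only *)
(* the cyclic groups and the 'Q_(2 ^ m). Conversely, every vertex is joined to *)
(* a generator if G is cyclic, and to b ^+ 2 if G is generalized quaternion.   *)
(* If G is nilpotent but not a p-group, vertices x and y of distinct prime     *)
(* orders commute and are both powers of x * y, and two vertices of the same   *)
(* prime order are joined through one of another prime order.                  *)

Require Import Defs.
From mathcomp Require Import all_boot all_order all_fingroup all_solvable.
From mathcomp Require Import zmodp.

Set Implicit Arguments.
Unset Strict Implicit.
Unset Printing Implicit Defensive.

Import GroupScope.

(** For p-groups, necessity rests on the edge invariant [connect_Ohm1] and the classification
    [prime_Ohm1P] of p-groups with a single subgroup of order p; [quaternion_class_generalized] then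
    passes to the presentation. Conversely, for a presented group the delicate point is that the hub
    [b ^+ 2] is not 1, which comes from the bound [generalized_quaternion_dvd] on the 2-part of the
    order. Nilpotency enters through [connect_prime_order]: elements of coprime orders commute. *)

Lemma power_graph_connect_sym (gT : finGroupType) (G : {set gT}) :
  connect_sym (power_graph G).
Proof.
apply: sym_connect_sym => x y; rewrite /power_graph /= andbCA eq_sym.
by rewrite [(x \in _) || _]orbC.
Qed.

Lemma connect_power_cycle (gT : finGroupType) (G : {set gT}) (x y : gT) :
  x \in G^# -> y \in G^# -> x \in <[y]> -> connect (power_graph G) x y.
Proof.
move=> Gx Gy xy; have [->|neq_xy] := eqVneq x y; first exact: connect0.
by apply: connect1; rewrite /power_graph /= Gx Gy neq_xy xy.
Qed.

Lemma power_graph_connected_hub (gT : finGroupType) (G : {set gT}) (z : gT) :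
  {in G^#, forall x, connect (power_graph G) x z} -> power_graph_connected G.
Proof.
move=> toz x y Gx Gy; apply: connect_trans (toz x Gx) _.
by rewrite power_graph_connect_sym toz.
Qed.

Lemma cyclic_power_graph_connected (gT : finGroupType) (G : {group gT}) :
  cyclic G -> power_graph_connected G.
Proof.
case/cyclicP=> g defG; apply: (power_graph_connected_hub (z := g)) => x Gx.
have [ntx Gxg] := setD1P Gx; rewrite defG in Gxg.
apply: connect_power_cycle => //; rewrite !inE defG cycle_id andbT.
by apply: contraNneq ntx => g1; rewrite g1 cycle1 inE in Gxg.
Qed.

Lemma connect_prime_order (gT : finGroupType) (G : {group gT}) (x y : gT) :
    nilpotent G -> x \in G -> y \in G -> prime #[x] -> prime #[y] ->
  #[x] != #[y] -> connect (power_graph G) x y.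
Proof.
move=> nilG Gx Gy px py neq.
have co_xy: coprime #[x] #[y] by rewrite prime_coprime // dvdn_prime2.
have cxy: commute x y.
  apply/commute_sym/cent1P; rewrite -cent_cycle -cycle_subG.
  by apply: (sub_nilpotent_cent2 nilG); rewrite ?cycle_subG // -!orderE.
have oxy: #[x * y] = (#[x] * #[y])%N by rewrite orderM.
have nt_prime (z : gT) : prime #[z] -> z != 1.
  by move=> pz; rewrite -order_gt1 prime_gt1.
have Gxy: x * y \in G^#.
  rewrite !inE groupM // andbT -order_gt1 oxy.
  by rewrite (leq_trans (prime_gt1 px)) // leq_pmulr ?order_gt0.
(* As [x] and [y] commute and have coprime orders, [x * y] generates the product of their cycles. *)
have sub z : z \in <[x]> <*> <[y]> -> z \in <[x * y]>.
  by rewrite cent_joinEl -?cycleM // cent_cycle cycle_subG; apply/cent1P.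
apply: (connect_trans (y := x * y)); last rewrite power_graph_connect_sym.
  apply: connect_power_cycle; rewrite // ?in_setD1 ?nt_prime ?Gx //.
  by rewrite sub // -cycle_subG joing_subl.
apply: connect_power_cycle; rewrite // ?in_setD1 ?nt_prime ?Gy //.
by rewrite sub // -cycle_subG joing_subr.
Qed.

Lemma not_pgroup_power_graph_connected (gT : finGroupType) (G : {group gT}) :
    nilpotent G -> (forall p : nat, prime p -> ~~ p.-group G) ->
  power_graph_connected G.
Proof.
move=> nilG npG.
have other p : exists z, [/\ z \in G, prime #[z] & #[z] != p].
  have [q [q_pr q_dvd neq]]: exists q, [/\ prime q, q %| #|G| & q != p].
    have [p_pr|np] := boolP (prime p); last first.
      have G_gt1: 1 < #|G|.
        (* The trivial group is a 2-group, hence excluded by [npG]. *)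
        rewrite cardG_gt1; apply: contraNneq (npG 2 isT) => ->.
        exact: pgroup1.
      exists (pdiv #|G|); rewrite pdiv_prime ?pdiv_dvd //; split=> //.
      by apply: contraNneq np => <-; apply: pdiv_prime.
    move: (npG p p_pr); rewrite /pgroup /pnat cardG_gt0 /= => /allPn[q].
    by rewrite mem_primes => /and3P[q_pr _ q_dvd] neq; exists q.
  have [z Gz oz] := Cauchy q_pr q_dvd.
  by exists z; rewrite oz.
have prime_conn x y : x \in G -> y \in G -> prime #[x] -> prime #[y] ->
    connect (power_graph G) x y.
  move=> Gx Gy px py; have [eq_xy|] := eqVneq #[x] #[y]; last first.
    exact: connect_prime_order.
  have [z [Gz pz neq]] := other #[x].
  apply: (connect_trans (y := z)); apply: connect_prime_order => //.
    by rewrite eq_sym.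
  by rewrite -eq_xy.
have to_prime x : x \in G^# ->
    exists z, [/\ z \in G, prime #[z] & connect (power_graph G) x z].
  move=> Gx; have [ntx xG] := setD1P Gx.
  have x_gt1: 1 < #[x] by rewrite order_gt1.
  have [z xz oz] := Cauchy (pdiv_prime x_gt1) (pdiv_dvd #[x]).
  have Gz: z \in G by apply: subsetP xz; rewrite cycle_subG.
  have pz: prime #[z] by rewrite oz pdiv_prime.
  exists z; split=> //; rewrite power_graph_connect_sym.
  by apply: connect_power_cycle; rewrite // !inE Gz -order_gt1 prime_gt1.
move=> x y /to_prime[z [Gz pz xz]] /to_prime[t [Gt pt yt]].
apply: connect_trans xz _; apply: connect_trans (prime_conn z t _ _ _ _) _ => //.
by rewrite power_graph_connect_sym.
Qed.

(** Along an edge one cycle contains the other, hence so do their ['Ohm_1]; both have order [p], so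
    they coincide. *)
Lemma connect_Ohm1 (gT : finGroupType) (G : {group gT}) (p : nat) (x y : gT) :
    p.-group G -> connect (power_graph G) x y ->
  'Ohm_1(<[x]>) = 'Ohm_1(<[y]>).
Proof.
move=> pG /connectP[s]; elim: s x => [|z s IHs] x /=; first by move=> _ ->.
case/andP=> xz /IHs{}IHs /IHs <- {IHs}.
wlog: x z xz / x \in <[z]> => [IH|].
  case/and4P: (xz) => Gx Gz neq /orP[|zx]; first exact: IH.
  by rewrite (IH z x) // /power_graph /= Gx Gz eq_sym neq zx.
case/and4P: xz => /setD1P[ntx Gx] /setD1P[ntz Gz] _ _ xz.
have card1 t : t \in G -> t != 1 -> #|'Ohm_1(<[t]>)| = p.
  move=> Gt ntt; apply: Ohm1_cyclic_pgroup_prime; rewrite ?cycle_cyclic //.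
    by apply: pgroupS pG; rewrite cycle_subG.
  by rewrite cycle_eq1.
apply/eqP; rewrite eqEcard !card1 // leqnn andbT.
by apply: OhmS; rewrite cycle_subG.
Qed.

(** Elements of prime order generate ['Ohm_1(G)], and [connect_Ohm1] puts each of them in the cycle
    of one fixed [u] of order [p]. *)
Lemma power_graph_connected_Ohm1 (gT : finGroupType) (G : {group gT}) (p : nat) :
    p.-group G -> G :!=: 1 -> power_graph_connected G -> #|'Ohm_1(G)| = p.
Proof.
move=> pG ntG conG; have [p_pr p_dvd _] := pgroup_pdiv pG ntG.
have [u Gu ou] := Cauchy p_pr p_dvd.
have pu: prime #[u] by rewrite ou.
suffices ->: 'Ohm_1(G) = <[u]> by rewrite -orderE.
apply/eqP; rewrite eqEsubset Ohm1Eprime cycle_subG mem_gen ?inE ?Gu ?pu //.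
rewrite gen_subG andbT; apply/subsetP=> x; rewrite inE => /andP[Gx px].
have xO: x \in 'Ohm_1(<[x]>).
  by rewrite Ohm1Eprime mem_gen // inE cycle_id.
apply: (subsetP (Ohm_sub 1 _)).
rewrite -(connect_Ohm1 (x := x) pG) //.
by apply: conG; rewrite !inE ?Gx ?Gu -order_gt1 prime_gt1.
Qed.

(** With r = [2 ^ n.-2], the relations x^(2r) = 1, y^2 = x^r of [Grp_quaternion] are equivalent to
    x^r = y^2, y^4 = 1, so both presentations have the same images. *)
Lemma quaternion_class_generalized (gT : finGroupType) (G : {group gT}) :
  extremal_class G = Quaternion -> generalized_quaternion G.
Proof.
case/quaternion_classP=> n n_gt2 isoG; exists (2 ^ n.-2)%N.
  by case: n n_gt2 {isoG} => [|[|[|n]]] // _; rewrite expnS leq_pmulr ?expn_gt0.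
apply: (isoGrp_trans isoG) => rT H; rewrite (Grp_quaternion n_gt2).
have def_n: (2 ^ n.-1 = 2 ^ n.-2 * 2)%N.
  by case: n n_gt2 {isoG} => [|[|n]] // _; rewrite /= expnSr.
apply/existsP/existsP=> -[[x y]] /=.
  case/eqP=> defH xq y2 xy; exists (x, y); rewrite /= !xpair_eqE defH y2 !eqxx /=.
  rewrite -[_ * x * y]mulgA -/(x ^ y) xy mulVg eqxx /=.
  by rewrite (expgM y 2 2) y2 -expgM -def_n xq.
case/eqP=> defH xr y1 y4; exists (x, y); rewrite /= !xpair_eqE defH xr eqxx /=.
rewrite def_n expgM xr -expgM y4 !eqxx /=.
by rewrite -(inj_eq (mulIg x)) mulVg conjgE mulgA y1.
Qed.

(* G maps onto 'Q_(4 * n`_2), or onto 'Z_4 when n is odd. The relations with   *)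
(* b ^+ 2 = 1 added only allow #|G| %| n * 2, so b ^+ 2 != 1 in G.             *)
Lemma generalized_quaternion_dvd (gT : finGroupType) (G : {group gT}) (n : nat) :
    0 < n ->
    G \isog Grp (a : b : (a ^+ n = b ^+ 2, b^-1 * a * b * a = b ^+ 4 = 1)) ->
  2 ^ (logn 2 n).+2 %| #|G|.
Proof.
move=> n_gt0 isoG; set k := logn 2 n.
have [m odd_m def_n]: exists2 m, odd m & n = (m * 2 ^ k)%N.
  have [m co_m def_n] := pfactor_coprime (isT : prime 2) n_gt0.
  by exists m; rewrite -?coprime2n.
(* The [2 ^ k]-th power of the image of a will have square 1, so the odd factor [m] of [n] does not
   change it. *)
have odd_exp (rT : finGroupType) (w : rT) : w ^+ 2 = 1 -> w ^+ m = w.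
  move=> w2; rewrite -[m]odd_double_half odd_m expgD -mul2n expgM w2.
  by rewrite expg1n mulg1.
move: k def_n => [|k] def_n.
  suffices: #|[set: 'Z_4]| %| #|G| by rewrite cardsT card_ord.
  apply: card_homg; rewrite isoG; apply/existsP.
  (* Additively a = 2 and b = 1 modulo 4. *)
  exists (Zp1 ^+ 2, Zp1); rewrite /= !xpair_eqE def_n muln1 odd_exp; last exact: val_inj.
  by rewrite -Zp_cycle eqxx andbT eqEsubset join_subG !subsetT joing_subr.
have k_gt2: 2 < k.+3 by [].
rewrite -(card_quaternion k_gt2); apply: card_homg; rewrite isoG.
have := isoGrp_hom (Grp_quaternion k_gt2).
case/existsP=> -[x y] /= /eqP[defQ xq y2 xy]; apply/existsP; exists (x, y).
rewrite /= !xpair_eqE defQ eqxx /= def_n mulnC expgM odd_exp; last first.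
  by rewrite -expgM -expnSr.
rewrite y2 eqxx -[_ * x * y]mulgA -/(x ^ y) xy mulVg eqxx /=.
by rewrite (expgM y 2 2) y2 -expgM -expnSr xq.
Qed.

Lemma generalized_quaternion_power_graph_connected
    (gT : finGroupType) (G : {group gT}) :
  generalized_quaternion G -> power_graph_connected G.
Proof.
case=> n n_gt1 isoG; have n_gt0: 0 < n by apply: ltnW.
have dvdG := generalized_quaternion_dvd n_gt0 isoG.
have := isoGrp_hom isoG; case/existsP=> -[a b] /= /eqP[defG an ab _].
have ab': a ^ b = a^-1.
  by apply: (mulIg a); rewrite mulVg -ab conjgE mulgA.
have {}defG: <[a]> * <[b]> = G.
  by rewrite -norm_joinEr // norms_cycle ab' groupV cycle_id.
have Ga: a \in G by rewrite -cycle_subG -defG mulG_subl.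
have Gb: b \in G by rewrite -cycle_subG -defG mulG_subr.
have az: b ^+ 2 \in <[a]> by rewrite -an mem_cycle.
have ntz: b ^+ 2 != 1.
  apply: contraTneq dvdG => b2.
  have dvdG2: #|G| %| n * 2.
    apply: (@dvdn_trans (#|<[a]>| * #|<[b]>|)).
      by rewrite mul_cardG defG dvdn_mulr.
    by apply: dvdn_mul; rewrite order_dvdn ?an ?b2.
  apply/negP=> /dvdn_trans/(_ dvdG2).
  rewrite pfactor_dvdn ?muln_gt0 ?n_gt0 // lognM // -[in logn 2 2](expn1 2).
  by rewrite pfactorK // addn1 ltnn.
have nta: a != 1 by apply: contraNneq ntz => a1; rewrite -an a1 expg1n.
have Gz: b ^+ 2 \in G^# by rewrite !inE ntz groupX.
apply: (power_graph_connected_hub (z := b ^+ 2)) => x Gx.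
have [xa | x'a] := boolP (x \in <[a]>).
  have Ga': a \in G^# by rewrite !inE nta.
  apply: connect_trans (connect_power_cycle Gx Ga' xa) _.
  by rewrite power_graph_connect_sym connect_power_cycle.
rewrite power_graph_connect_sym connect_power_cycle //.
have [_ xG] := setD1P Gx; move: xG x'a; rewrite -defG.
case/mulsgP=> u _ ua /cycleP[j ->] ->.
(* Even powers of [b] are absorbed into [<[a]>], so x = v b, and x^2 = v b^2 v^-1 = b^2. *)
rewrite -[j]odd_double_half -mul2n addnC expgD mulgA expgM.
set v := u * _; have va: v \in <[a]> := groupM ua (groupX _ az).
case: (odd j); rewrite ?expg0 ?mulg1 ?va //= => _.
suffices <-: (v * b) ^+ 2 = b ^+ 2 by apply: mem_cycle.
have vb: v ^ b = v^-1 by case/cycleP: va => i ->; rewrite conjXg ab' expgVn.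
have cvz: commute v (b ^+ 2).
  by case/cycleP: va => i ->; rewrite -an; apply: commuteX2.
by rewrite expg2 -mulgA [v * b]conjgC vb (mulgA b) -expg2 mulgA cvz mulgK.
Qed.

Theorem theorem2p7 (gT : finGroupType) (G : {group gT}) (nilG : nilpotent G) :
  power_graph_connected G <->
  [\/ cyclic G, generalized_quaternion G
    | forall p : nat, prime p -> ~~ p.-group G].
Proof.
split=> [conG|]; last first.
  case=> [|| npG].
  - exact: cyclic_power_graph_connected.
  - exact: generalized_quaternion_power_graph_connected.
  exact: not_pgroup_power_graph_connected.
have [->|ntG] := eqVneq (G : {set gT}) 1; first by constructor 1; apply: cyclic1.
have [pG|npG] := boolP ((pdiv #|G|).-group G); last first.
  (* A nontrivial p-group has [pdiv #|G|] equal to p, so this is the only prime to test. *)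
  constructor 3=> p p_pr; apply: contra npG => pG.
  by have [_ _ [k ->]] := pgroup_pdiv pG ntG; rewrite pdiv_pfactor ?card_pgroup.
have /(prime_Ohm1P pG ntG) := power_graph_connected_Ohm1 pG ntG conG.
case/orP=> [cycG | /andP[_ /eqP/quaternion_class_generalized]].
  by constructor 1.
by constructor 2.
Qed.
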